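(* As formal power series in $q$, $$f(q^5,q^3)^2-q\,f(q,q^7)^2=\varphi(q)\varphi(q^2).$$
   Context: $f(u,v)=\sum_{j=-\infty}^\infty u^{j(j-1)/2}v^{j(j+1)/2}$ and $\varphi(q)=\prod_{j=1}^\infty(1-q^j)$. *)

(* Defs.v *)
From HB Require Import structures.
From mathcomp Require Import all_boot all_order all_algebra.
From mathcomp Require Import boolp classical_sets cardinality fsbigop.
From mathcomp Require Import zify.

Set Implicit Arguments.
Unset Strict Implicit.
Unset Printing Implicit Defensive.

Import Order.TTheory GRing.Theory Num.Theory.
Local Open Scope ring_scope.

(* The ring Z[[q]], a series being given by its sequence of coefficients;
   the record keeps the Cauchy product apart from the pointwise product that
   functions into a ring may carry. *)
Record fps := Fps { coef : nat -> int }.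

HB.instance Definition _ := gen_eqMixin fps.
HB.instance Definition _ := gen_choiceMixin fps.

Lemma fpsP (f g : fps) : coef f =1 coef g -> f = g.
Proof. by case: f g => [f] [g] /funext /= ->. Qed.

Definition fps_zero := Fps (fun=> 0).
Definition fps_opp f := Fps (fun n => - coef f n).
Definition fps_add f g := Fps (fun n => coef f n + coef g n).
Definition fps_one := Fps (fun n => (n == 0)%:R).
Definition fps_mul f g :=
  Fps (fun n => \sum_(i < n.+1) coef f i * coef g (n - i)%N).

Fact fps_addA : associative fps_add.
Proof. by move=> f g h; apply: fpsP => n /=; rewrite addrA. Qed.
Fact fps_addC : commutative fps_add.
Proof. by move=> f g; apply: fpsP => n /=; rewrite addrC. Qed.
Fact fps_add0 : left_id fps_zero fps_add.
Proof. by move=> f; apply: fpsP => n /=; rewrite add0r. Qed.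
Fact fps_addN : left_inverse fps_zero fps_opp fps_add.
Proof. by move=> f; apply: fpsP => n /=; rewrite addNr. Qed.

HB.instance Definition _ :=
  GRing.isZmodule.Build fps fps_addA fps_addC fps_add0 fps_addN.

(* The ring axioms are transported from {poly int} by truncation. *)
Definition fps_agree N (f : fps) (p : {poly int}) :=
  forall n, (n <= N)%N -> coef f n = p`_n.

Lemma fps_agree_mul N f g p r : fps_agree N f p -> fps_agree N g r ->
  fps_agree N (fps_mul f g) (p * r).
Proof.
move=> fp gr n nN /=; rewrite coefM; apply: eq_bigr => i _.
by rewrite fp ?gr //; have := ltn_ord i; lia.
Qed.

Lemma fps_agree_trunc N f : fps_agree N f (\poly_(i < N.+1) coef f i).
Proof. by move=> n nN; rewrite coef_poly ltnS nN. Qed.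

Fact fps_mulA : associative fps_mul.
Proof.
move=> f g h; apply: fpsP => N.
have [[F G] H] := (fps_agree_trunc (N:=N) f, fps_agree_trunc (N:=N) g,
                 fps_agree_trunc (N:=N) h).
rewrite (fps_agree_mul F (fps_agree_mul G H) (leqnn N)).
by rewrite (fps_agree_mul (fps_agree_mul F G) H (leqnn N)) mulrA.
Qed.

Fact fps_mulC : commutative fps_mul.
Proof.
move=> f g; apply: fpsP => N.
have [F G] := (fps_agree_trunc (N:=N) f, fps_agree_trunc (N:=N) g).
by rewrite (fps_agree_mul F G (leqnn N)) (fps_agree_mul G F (leqnn N)) mulrC.
Qed.

Fact fps_mul1 : left_id fps_one fps_mul.
Proof.
move=> f; apply: fpsP => n /=; rewrite big_ord_recl mul1r subn0.
by rewrite big1 ?addr0 // => i _; rewrite mul0r.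
Qed.

Fact fps_mulD : left_distributive fps_mul +%R.
Proof.
move=> f g h; apply: fpsP => n /=; rewrite -big_split /=.
by apply: eq_bigr => i _; rewrite mulrDl.
Qed.

Fact fps_one_neq0 : fps_one != 0.
Proof. by apply/eqP => /(congr1 (coef ^~ 0)). Qed.

HB.instance Definition _ := GRing.Zmodule_isComNzRing.Build fps
  fps_mulA fps_mulC fps_mul1 fps_mulD fps_one_neq0.

Definition fps_q : fps := Fps (fun n => (n == 1)%:R).

(* The formal sum is taken coefficientwise; [\sum_(j \in _) _] is 0 when the
   support is infinite, so [fps_sum] is meaningful for summable families. *)
Definition fps_summable (I : choiceType) (F : I -> fps) :=
  forall n, finite_set [set j | coef (F j) n <> 0]%classic.

Definition fps_sum (I : choiceType) (F : I -> fps) : fps :=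
  Fps (fun n => \sum_(j \in [set: I]%classic) coef (F j) n).

(* q-adic convergence: every coefficient is eventually constant. *)
Definition fps_cvg (u : nat -> fps) (l : fps) :=
  forall n, exists N, forall m, (N <= m)%N -> coef (u m) n = coef l n.

Definition fps_lim (u : nat -> fps) : fps := xget 0 [set l | fps_cvg u l]%classic.

(* j(j-1)/2 and j(j+1)/2 are nonnegative for every integer j, so taking the
   absolute value after the exact division merely casts them to nat. *)
Definition theta_term (u v : fps) (j : int) : fps :=
  u ^+ `|((j * (j - 1)) %/ 2)%Z|%N * v ^+ `|((j * (j + 1)) %/ 2)%Z|%N.

Definition theta_f (u v : fps) : fps := fps_sum (theta_term u v).

Definition phi_partial (x : fps) (n : nat) : fps :=
  \prod_(1 <= j < n.+1) (1 - x ^+ j).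

Definition phi (x : fps) : fps := fps_lim (phi_partial x).

(* The defining sum and product converge as soon as the arguments have zero
   constant term. *)
Definition fps_vanish m (f : fps) := forall n, (n < m)%N -> coef f n = 0.

Lemma fps_vanishM a b f g :
  fps_vanish a f -> fps_vanish b g -> fps_vanish (a + b) (f * g).
Proof.
move=> fa gb n nab; apply: big1 => i _; have := ltn_ord i => ilt.
have [ia|ai] := ltnP i a; first by rewrite fa ?mul0r.
by rewrite gb ?mulr0 //; lia.
Qed.

Lemma fps_vanishX f m : coef f 0 = 0 -> fps_vanish m (f ^+ m).
Proof.
move=> f0; elim: m => [|m IH]; first by case.
by rewrite exprS -add1n; apply: fps_vanishM => // -[].
Qed.

Lemma theta_summable u v :
  coef u 0 = 0 -> coef v 0 = 0 -> fps_summable (theta_term u v).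
Proof.
move=> u0 v0 n.
pose s := [seq i%:Z | i <- iota 0 n.+1] ++ [seq - i%:Z | i <- iota 0 n.+1].
apply: (@sub_finite_set _ _ [set` s]%classic); last exact: finite_seq.
move=> j nz; suff : j \in s by [].
have jn : (`|j|%N <= n)%N.
  rewrite leqNgt; apply/negP => nj; apply: nz.
  apply: (fps_vanishM (fps_vanishX (m:=_) u0) (fps_vanishX (m:=_) v0)).
  apply: (leq_trans nj).
  have [k jk] : exists k, j * (j - 1) = k * 2.
    have [i [->|->]] : exists i : int, j = i * 2 \/ j = i * 2 + 1.
      by exists (j %/ 2)%Z; lia.
    - by exists (i * (i * 2 - 1)); lia.
    - by exists (i * (i * 2 + 1)); lia.
  have jk' : j * (j + 1) = (k + j) * 2 by lia.
  by rewrite jk jk' !mulzK //; nia.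
rewrite mem_cat; apply/orP; have [j0|j0] := leP 0 j.
  by left; apply/mapP; exists `|j|%N; rewrite ?mem_iota; lia.
by right; apply/mapP; exists `|j|%N; rewrite ?mem_iota; lia.
Qed.

Lemma phi_cvg x : coef x 0 = 0 -> fps_cvg (phi_partial x) (phi x).
Proof.
move=> x0; rewrite /phi /fps_lim; apply: xgetPex.
exists (Fps (fun n => coef (phi_partial x n) n)) => n; exists n => m nm /=.
rewrite -(subnKC nm); elim: (m - n)%N => [|k IH]; first by rewrite addn0.
rewrite addnS -[RHS]IH -[RHS]subr0.
have -> : phi_partial x (n + k).+1 =
    phi_partial x (n + k) - phi_partial x (n + k) * x ^+ (n + k).+1.
  by rewrite {1}/phi_partial big_nat_recr //= mulrBr mulr1.
congr (_ - _).
by apply: (@fps_vanishM 0 (n + k).+1); [case | exact: fps_vanishX | lia].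
Qed.

(* Main.v *)
Require Import Defs.
From HB Require Import structures.
From mathcomp Require Import all_boot all_order all_algebra.
From mathcomp Require Import boolp classical_sets cardinality fsbigop.
From mathcomp Require Import zify ring.

Import GRing.Theory.
Local Open Scope ring_scope.

(* Both sides equal f(-q^2,-q^2) f(-q^3,-q) = sum (-1)^(d+s) q^(2d^2+2s^2-s).
   The terms with d = s mod 2 are parametrized by (d,s) = (a-b,a+b) and sum to
   f(q^5,q^3)^2; those with d <> s mod 2 by (d,s) = (a-b,a+b+1), summing to
   -q f(q,q^7)^2. On the other hand, by Jacobi's triple product the two factors
   are prod (1-q^(4n))(1-q^(4n-2))^2 and prod (1-q^(4n))(1-q^(4n-1))(1-q^(4n-3)),
   and together these factors are exactly those of phi(q) phi(q^2).
   The triple product is the q-adic limit of its finite form, an instance of the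
   q-binomial theorem. *)

(** * Gaussian binomial coefficients and q-factorials *)

(* The truncated [M - k] is harmless: [gauss Q M k] is 0 when [M < k]. *)
Fixpoint gauss (R : comPzRingType) (Q : R) (M k : nat) : R :=
  match M, k with
  | _, 0 => 1
  | 0, _ => 0
  | M.+1, k.+1 => gauss R Q M k.+1 + Q ^+ (M - k) * gauss R Q M k
  end.
Arguments gauss {R} Q M k : simpl never.

Section GaussianBinomial.
Variables (R : comPzRingType) (Q : R).
Implicit Types M k n : nat.

Lemma gaussSl M k :
  gauss Q M.+1 k.+1 = gauss Q M k.+1 + Q ^+ (M - k) * gauss Q M k.
Proof. by []. Qed.

Lemma gauss0 M : gauss Q M 0 = 1. Proof. by case: M. Qed.

Lemma gauss_small M k : (M < k)%N -> gauss Q M k = 0.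
Proof.
elim: M k => [|M IH] [|k] //= Mk.
by rewrite gaussSl !IH ?mulr0 ?addr0 //; lia.
Qed.

Definition qfact n : R := \prod_(i < n) (1 - Q ^+ i.+1).

Lemma qfactS n : qfact n.+1 = qfact n * (1 - Q ^+ n.+1).
Proof. exact: big_ord_recr. Qed.

Lemma gaussnn M : gauss Q M M = 1.
Proof.
elim: M => [//|M IH].
by rewrite gaussSl IH subnn gauss_small ?mulr1 ?add0r.
Qed.

(** The quotient formula for Gaussian binomials, kept free of division because [R] is any
    commutative ring. The induction rests on 1 - Q^(M+1) = (1 - Q^(M-k)) + Q^(M-k) (1 - Q^(k+1)). *)
Lemma gauss_qfact M k : (k <= M)%N ->
  gauss Q M k * qfact k * qfact (M - k) = qfact M.
Proof.
elim: M k => [|M IH] [|k] kM //.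
- by rewrite gauss0 /qfact big_ord0 !mulr1.
- by rewrite gauss0 subn0 /qfact big_ord0 !mul1r.
have [->|ltkM] := eqVneq k M.
  by rewrite gaussnn subnn {2}/qfact big_ord0 mul1r mulr1.
have Mk : (k < M)%N by lia.
rewrite subSS gaussSl mulrDl mulrDl.
have e : (M - k)%N = (M - k.+1).+1 by lia.
have h1 := IH k.+1 Mk; have h2 := IH k (ltnW Mk).
have hq : qfact (M - k) = qfact (M - k.+1) * (1 - Q ^+ (M - k)).
  by rewrite {1}e qfactS -e.
rewrite {1}hq [_ * qfact k.+1 * (_ * _)]mulrA h1 [qfact k.+1]qfactS [qfact M.+1]qfactS.
have -> : Q ^+ (M - k) * gauss Q M k * (qfact k * (1 - Q ^+ k.+1)) * qfact (M - k)
  = Q ^+ (M - k) * (1 - Q ^+ k.+1) * (gauss Q M k * qfact k * qfact (M - k)) by ring.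
have eM : M.+1 = (M - k + k.+1)%N by lia.
by rewrite h2 eM exprD; ring.
Qed.

(** Proved by its own induction: the q-factorials in [gauss_qfact] may be zero divisors, so they
    cannot be cancelled. *)
Lemma gauss_ratio M k : (k <= M)%N ->
  (1 - Q ^+ k.+1) * gauss Q M k.+1 = (1 - Q ^+ (M - k)) * gauss Q M k.
Proof.
elim: M k => [|M IH] k kM.
  by case: k kM => //= _; rewrite subrr mulr0 mul0r.
case: k kM => [|k] kM.
  have := IH 0%N (leq0n _); rewrite gaussSl !gauss0 !subn0 !mulr1 mulrDr => ->.
  by rewrite expr1 exprS; ring.
have [->|neqkM] := eqVneq k M.
  by rewrite gauss_small // subnn subrr mulr0 mul0r.
have Mk : (k < M)%N by lia.
have h1 := IH k.+1 Mk; have h2 := IH k (ltnW Mk).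
rewrite subSS [gauss _ M.+1 k.+2]gaussSl mulrDr h1 [gauss _ M.+1 k.+1]gaussSl mulrDr.
have -> : (1 - Q ^+ (M - k)) * (Q ^+ (M - k) * gauss Q M k) =
  Q ^+ (M - k) * ((1 - Q ^+ k.+1) * gauss Q M k.+1) by rewrite h2; ring.
have -> : (M - k)%N = (M - k.+1).+1 by lia.
by rewrite !exprS; ring.
Qed.

(** The mirror Pascal rule: [gauss_ratio] trades one weight for the other. In the finite triple
    product this rule adjoins a factor in [u], and [gaussSl] one in [v]. *)
Lemma gaussSr M k :
  gauss Q M.+1 k.+1 = Q ^+ k.+1 * gauss Q M k.+1 + gauss Q M k.
Proof.
have [kM|Mk] := leqP k M; last by rewrite !gauss_small ?mulr0 ?addr0 //; lia.
have h := gauss_ratio M k kM.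
transitivity (Q ^+ k.+1 * gauss Q M k.+1 + (1 - Q ^+ k.+1) * gauss Q M k.+1
              + Q ^+ (M - k) * gauss Q M k); first by rewrite gaussSl; ring.
by rewrite h; ring.
Qed.

End GaussianBinomial.

Arguments qfact {R} Q n.

(** * The exponents of the theta terms *)

Definition lower_tri (j : int) : nat := `|((j * (j - 1)) %/ 2)%Z|%N.
Definition upper_tri (j : int) : nat := `|((j * (j + 1)) %/ 2)%Z|%N.

Lemma theta_termE u v j :
  theta_term u v j = u ^+ lower_tri j * v ^+ upper_tri j.
Proof. by []. Qed.

Lemma lower_triE j : (lower_tri j)%:Z * 2 = j * (j - 1).
Proof.
have [k jk] : exists k, j * (j - 1) = k * 2.
  have [i [->|->]] : exists i : int, j = i * 2 \/ j = i * 2 + 1.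
    by exists (j %/ 2)%Z; lia.
  - by exists (i * (i * 2 - 1)); lia.
  - by exists (i * (i * 2 + 1)); lia.
by rewrite /lower_tri jk mulzK //; nia.
Qed.

Lemma upper_tri_succ j k : k = j + 1 -> upper_tri j = lower_tri k.
Proof. by move=> ->; rewrite /upper_tri /lower_tri addrK mulrC. Qed.

Lemma upper_triE j : (upper_tri j)%:Z = (lower_tri j)%:Z + j.
Proof.
have := lower_triE j; have := lower_triE (j + 1).
rewrite -(upper_tri_succ j _ erefl); nia.
Qed.

(** * The finite triple product *)

Section FiniteTripleProduct.
Variables u v : fps.
Local Notation Q := (u * v).
Local Notation t := (theta_term u v).
Implicit Types (m n e : nat) (j k : int).

(** The ratio of consecutive terms t(j+1)/t(j) is v Q^j. As j may be negative and [Q] has no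
    inverse, Q^j is written as a quotient of Q^n by Q^e. *)
Lemma theta_term_up n e j k : k = j + 1 -> j + e%:Z = n%:Z ->
  Q ^+ e * t k = v * Q ^+ n * t j.
Proof.
move=> kj jen; rewrite !theta_termE !exprMn.
have [[h0 h1] h2] := (upper_tri_succ j k kj, upper_triE j, upper_triE k).
have e1 : (e + lower_tri k = n + lower_tri j)%N by lia.
have e2 : (e + upper_tri k = n.+1 + upper_tri j)%N by lia.
transitivity (u ^+ (e + lower_tri k) * v ^+ (e + upper_tri k)).
  by rewrite !exprD; ring.
by rewrite e1 e2 !exprD exprS; ring.
Qed.

Lemma theta_term_down m e j k : j = k + 1 -> j + m%:Z = e%:Z ->
  Q ^+ e * t k = u * Q ^+ m * t j.
Proof.
move=> jk jme; rewrite !theta_termE !exprMn.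
have [[h0 h1] h2] := (upper_tri_succ k j jk, upper_triE j, upper_triE k).
have e1 : (e + lower_tri k = m.+1 + lower_tri j)%N by lia.
have e2 : (e + upper_tri k = m + upper_tri j)%N by lia.
transitivity (u ^+ (e + lower_tri k) * v ^+ (e + upper_tri k)).
  by rewrite !exprD; ring.
by rewrite e1 e2 !exprD exprS; ring.
Qed.

(* As [m, n] grow each coefficient [gauss] tends to the inverse of the infinite
   product of the [1 - Q ^+ i], which gives Jacobi's triple product. *)
Lemma finite_triple_product m n :
  \prod_(i < m) (1 + u * Q ^+ i) * \prod_(i < n) (1 + v * Q ^+ i) =
  \sum_(k < (m + n).+1) gauss Q (m + n) k * t (k%:Z - m%:Z).
Proof.
elim: n => [|n IHn].
  rewrite big_ord0 mulr1 addn0; elim: m => [|m IHm].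
    by rewrite big_ord0 big_ord1 /= theta_termE !expr0 !mulr1.
  rewrite big_ord_recr /= IHm mulrDr mulr1 [RHS]big_ord_recl [gauss _ _ ord0]gauss0 mul1r.
  under [X in _ = _ + X]eq_bigr => k _ do
    rewrite lift0 gaussSr mulrDl.
  rewrite big_split /= addrA [RHS]addrC; congr (_ + _).
    by apply: eq_bigr => k _; congr (_ * t _); lia.
  (* The lowest term and the terms weighted by [Q ^+ k.+1] form one sum, whose top term vanishes
     since [gauss Q m m.+1] is 0. *)
  transitivity (\sum_(k < m.+2) Q ^+ k * gauss Q m k * t (k%:Z - m.+1%:Z)).
    rewrite [RHS]big_ord_recr /= gauss_small // mulr0 mul0r addr0 mulr_suml.
    apply: eq_bigr => k _.
    have h : Q ^+ k * t (k%:Z - m.+1%:Z) = u * Q ^+ m * t (k%:Z - m%:Z).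
      by apply: theta_term_down; lia.
    by rewrite [RHS]mulrAC h; ring.
  by rewrite big_ord_recl [gauss _ _ ord0]gauss0 expr0 !mul1r.
rewrite big_ord_recr /= mulrA IHn addnS mulrDr mulr1.
rewrite [RHS]big_ord_recl [gauss _ _ ord0]gauss0 mul1r.
under [X in _ = _ + X]eq_bigr => k _ do rewrite lift0 gaussSl mulrDl.
rewrite big_split /= addrA; congr (_ + _).
  transitivity (\sum_(k < (m + n).+2) gauss Q (m + n) k * t (k%:Z - m%:Z)).
    by rewrite [RHS]big_ord_recr /= gauss_small // mul0r addr0.
  by rewrite big_ord_recl [gauss _ _ ord0]gauss0 mul1r.
rewrite mulr_suml; apply: eq_bigr => k _; have kl := ltn_ord k.
have h : Q ^+ (m + n - k) * t (k.+1%:Z - m%:Z) = v * Q ^+ n * t (k%:Z - m%:Z).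
  by apply: theta_term_up; lia.
by rewrite [RHS]mulrAC h; ring.
Qed.

End FiniteTripleProduct.

(** * Congruences modulo powers of q, and sums of summable families *)

Lemma fps_coef_sum (I : Type) (r : seq I) (P : pred I) (F : I -> fps) n :
  coef (\sum_(i <- r | P i) F i) n = \sum_(i <- r | P i) coef (F i) n.
Proof. exact: (big_morph (coef ^~ n)). Qed.

Lemma fps_coefD (f g : fps) n : coef (f + g) n = coef f n + coef g n.
Proof. by []. Qed.

Definition eq_mod N (f g : fps) := forall n, (n < N)%N -> coef f n = coef g n.

Lemma eq_modM N f f' g g' :
  eq_mod N f f' -> eq_mod N g g' -> eq_mod N (f * g) (f' * g').
Proof.
move=> ff gg n nN; apply: eq_bigr => i _; have := ltn_ord i => ilt.
by rewrite ff ?gg //; lia.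
Qed.

(** Coefficient n of [p * f] is that of [f] plus a combination of lower coefficients of [f], so
    agreement propagates by strong induction. *)
Lemma eq_mod_cancel N p f g : coef p 0 = 1 ->
  eq_mod N (p * f) (p * g) -> eq_mod N f g.
Proof.
move=> p0 pfg n; elim/ltn_ind: n => n IH nN.
have := pfg n nN; rewrite /= !big_ord_recl /= p0 !mul1r !subn0.
rewrite (eq_bigr (fun i : 'I_n => coef p (bump 0 i) * coef g (n - bump 0 i)%N)).
  by move/addIr.
by move=> i _; have := ltn_ord i => ilt; rewrite IH // /bump; lia.
Qed.

Lemma coef_fps_sum (I : choiceType) (F : I -> fps) (s : seq I) n :
  uniq s -> (forall j, coef (F j) n <> 0 -> j \in s) ->
  coef (fps_sum F) n = \sum_(j <- s) coef (F j) n.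
Proof.
move=> us Fs; rewrite /= (fsbigE s) //.
  by apply: eq_bigl => j; rewrite in_setT.
by move=> j _; apply: contraNP; exact: Fs.
Qed.

(** A single list must serve all degrees up to [N], because a Cauchy product mixes them. *)
Lemma fps_summable_seq (I : choiceType) (F : I -> fps) N : fps_summable F ->
  exists2 s : seq I, uniq s &
    forall n j, (n <= N)%N -> coef (F j) n <> 0 -> j \in s.
Proof.
move=> sF; elim: N => [|N [s us sP]].
  have /finite_seqP[r rE] := sF 0%N.
  exists (undup r); first exact: undup_uniq.
  move=> n j; rewrite leqn0 => /eqP -> Fj; rewrite mem_undup.
  by have : [set` r]%classic j by rewrite -rE.
have /finite_seqP[r rE] := sF N.+1.
exists (undup (r ++ s)); first exact: undup_uniq.
move=> n j; rewrite mem_undup mem_cat leq_eqVlt => /orP[/eqP-> Fj|nN Fj].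
  by rewrite (_ : j \in r) //; have : [set` r]%classic j by rewrite -rE.
by rewrite (sP n) ?orbT.
Qed.

Lemma fps_coefM_neq0 f g n : coef (f * g) n <> 0 ->
  exists2 k, (k <= n)%N & coef f k <> 0 /\ coef g (n - k) <> 0.
Proof.
move=> nz; apply: contrapT => no; apply: nz; apply: big1 => k _.
apply/eqP; rewrite mulf_eq0; apply/negPn; rewrite negb_or.
apply/negP => /andP[/eqP fk /eqP gk]; apply: no.
by exists k => //; have := ltn_ord k; lia.
Qed.

Lemma fps_summableM_seq (I J : choiceType) (F : I -> fps) (G : J -> fps) n
    (s : seq I) (t : seq J) :
  (forall k i, (k <= n)%N -> coef (F i) k <> 0 -> i \in s) ->
  (forall k j, (k <= n)%N -> coef (G j) k <> 0 -> j \in t) ->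
  forall p, coef (F p.1 * G p.2) n <> 0 -> p \in [seq (i, j) | i <- s, j <- t].
Proof.
move=> sP tP [i j] /fps_coefM_neq0[k kn [Fk Gk]].
apply/allpairsP; exists (i, j); split=> //=; first exact: sP Fk.
by apply: tP Gk; exact: leq_subr.
Qed.

Lemma fps_summableM (I J : choiceType) (F : I -> fps) (G : J -> fps) :
  fps_summable F -> fps_summable G ->
  fps_summable (fun p : I * J => F p.1 * G p.2).
Proof.
move=> sF sG n.
have [s _ sP] := fps_summable_seq _ _ n sF.
have [t _ tP] := fps_summable_seq _ _ n sG.
apply: (sub_finite_set _ (finite_seq [seq (i, j) | i <- s, j <- t])).
exact: fps_summableM_seq.
Qed.

Lemma fps_sumM (I J : choiceType) (F : I -> fps) (G : J -> fps) :
  fps_summable F -> fps_summable G ->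
  fps_sum F * fps_sum G = fps_sum (fun p : I * J => F p.1 * G p.2).
Proof.
move=> sF sG; apply: fpsP => n.
have [s us sP] := fps_summable_seq _ _ n sF.
have [t ut tP] := fps_summable_seq _ _ n sG.
rewrite (coef_fps_sum _ _ [seq (i, j) | i <- s, j <- t]).
- rewrite big_allpairs_dep /=.
  under [RHS]eq_bigr => i _ do rewrite exchange_big /=.
  rewrite exchange_big /=; apply: eq_bigr => k _; have kn := ltn_ord k.
  rewrite -[X in X * _]/(coef (fps_sum F) k) -[X in _ * X]/(coef (fps_sum G) _).
  rewrite (coef_fps_sum _ _ s) // ?(coef_fps_sum _ _ t) //; first last.
  + by move=> j; apply: sP; lia.
  + by move=> j; apply: tP; lia.
  by rewrite mulr_suml; apply: eq_bigr => i _; rewrite mulr_sumr.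
- by apply: allpairs_uniq => // -[? ?] [? ?].
exact: fps_summableM_seq.
Qed.

Lemma fps_sum_bij (I J : choiceType) (h : I -> J) (F : J -> fps) :
  bijective h -> fps_sum F = fps_sum (F \o h).
Proof. by move=> bh; apply: fpsP => n /=; rewrite (reindex_fsbigT h). Qed.

Lemma fps_sumU (I J : choiceType) (F : I + J -> fps) : fps_summable F ->
  fps_sum F = fps_sum (F \o inl) + fps_sum (F \o inr).
Proof.
move=> sF; apply: fpsP => n; have [s us sP] := fps_summable_seq _ _ n sF.
pose sl := pmap (fun p : I + J => if p is inl i then Some i else None) s.
pose sr := pmap (fun p : I + J => if p is inr j then Some j else None) s.
have slE i : (i \in sl) = (inl i \in s).
  by rewrite /sl; elim: (s) => //= -[i'|j] r IH /=; rewrite !inE IH.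
have srE j : (j \in sr) = (inr j \in s).
  by rewrite /sr; elim: (s) => //= -[i|j'] r IH /=; rewrite !inE IH.
have usl : uniq sl.
  by apply: (@pmap_uniq _ _ _ inl) us => -[].
have usr : uniq sr by apply: (@pmap_uniq _ _ _ inr) us => -[].
rewrite [RHS]fps_coefD (coef_fps_sum _ _ s) //; last by move=> p; apply: sP.
rewrite (coef_fps_sum _ _ sl) // ?(coef_fps_sum _ _ sr) //; first last.
- by move=> i; rewrite slE; apply: sP.
- by move=> i; rewrite srE; apply: sP.
rewrite /sl /sr; elim: (s) => [|[i|j] r IH] /=; rewrite ?big_nil ?addr0 //.
  by rewrite !big_cons IH addrA.
by rewrite !big_cons IH addrCA.
Qed.

(** * Passage to the limit: Jacobi's triple product *)

Lemma fps_vanish_theta_term u v j : coef u 0 = 0 -> coef v 0 = 0 ->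
  fps_vanish `|j| (theta_term u v j).
Proof.
move=> u0 v0 n nj.
apply: (fps_vanishM (fps_vanishX (m:=_) u0) (fps_vanishX (m:=_) v0)).
(* The two exponents add up to j^2, which is at least |j|. *)
apply: leq_trans nj _; rewrite -/(lower_tri j) -/(upper_tri j).
by have := lower_triE j; have := upper_triE j; nia.
Qed.

(** Every factor past the [N]-th is 1 modulo q^(N+1), as [Q] has zero constant term. *)
Lemma eq_mod_qfact N m n Q : coef Q 0 = 0 -> (N <= m)%N -> (N <= n)%N ->
  eq_mod N.+1 (qfact Q m) (qfact Q n).
Proof.
move=> Q0; suff {m n} h n : (N <= n)%N -> eq_mod N.+1 (qfact Q n) (qfact Q N).
  by move=> Nm Nn i iN; rewrite (h m) // (h n).
elim: n => [|n IH]; first by rewrite leqn0 => /eqP->.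
rewrite leq_eqVlt => /orP[/eqP-> //|Nn] k kN; rewrite qfactS mulrBr mulr1.
rewrite -(IH Nn k kN) -[RHS]subr0; congr (_ - _).
have := @fps_vanishM 0 n.+1 (qfact Q n) (Q ^+ n.+1).
by apply=> //; [exact: fps_vanishX | lia].
Qed.

Lemma coef0_qfact Q n : coef Q 0 = 0 -> coef (qfact Q n) 0 = 1.
Proof.
move=> Q0; rewrite (@eq_mod_qfact 0 n 0) //.
by rewrite /qfact big_ord0.
Qed.

(* From [gauss M k * qfact k * qfact (M - k) = qfact M], in which all three
   [qfact] agree modulo [q ^ N.+1]. *)
Lemma eq_mod_gauss N M k Q : coef Q 0 = 0 -> (N <= k)%N -> (N + k <= M)%N ->
  eq_mod N.+1 (qfact Q M * gauss Q M k) 1.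
Proof.
(* After multiplication by another [qfact Q M], both sides are [gauss Q M k] times two q-factorials,
   which agree factor by factor. *)
move=> Q0 Nk kM; apply: (@eq_mod_cancel _ (qfact Q M)).
  exact: coef0_qfact.
rewrite mulr1 -{3}(gauss_qfact _ Q M k); last by lia.
rewrite mulrC [X in eq_mod _ (X * _)]mulrC.
by apply: eq_modM; [apply: eq_modM => // |]; apply: eq_mod_qfact => //; lia.
Qed.

Lemma triple_product u v : coef u 0 = 0 -> coef v 0 = 0 ->
  fps_cvg (fun n => qfact (u * v) n *
    (\prod_(i < n) (1 + u * (u * v) ^+ i) * \prod_(i < n) (1 + v * (u * v) ^+ i)))
  (theta_f u v).
Proof.
(* For n >= 2N and |j| <= N, the index k = n + j satisfies N <= k and N + k <= 2n, as [eq_mod_gauss]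
   requires. *)
move=> u0 v0 N; exists (N + N)%N => n Nn.
have Q0 : coef (u * v) 0 = 0 by rewrite /= big_ord1 u0 mul0r.
(* Replacing [qfact n] by [qfact (n + n)] matches the upper index of the Gaussian binomials. *)
rewrite (@eq_modM N.+1 _ (qfact (u * v) (n + n)) _ _ (eq_mod_qfact _ _ _ _ Q0 _ _)
  (fun _ _ => erefl)) //; try lia.
rewrite finite_triple_product mulr_sumr fps_coef_sum.
pose s : seq int := [seq k%:Z - n%:Z | k <- iota 0 (n + n).+1].
rewrite (coef_fps_sum _ _ s); first last.
- move=> j nz; have jN : (`|j|%N <= N)%N.
    by rewrite leqNgt; apply/negP => Nj; apply: nz; apply: fps_vanish_theta_term.
  by apply/mapP; exists `|(j + n%:Z)%R|%N; rewrite ?mem_iota; lia.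
- by rewrite map_inj_uniq ?iota_uniq // => a b; lia.
rewrite big_map -[iota _ _]/(index_iota 0 (n + n).+1) big_mkord.
apply: eq_bigr => k _; rewrite mulrA.
(* For |j| <= N the coefficient of the theta term is 1 modulo q^(N+1); for larger |j| the theta term
   itself vanishes there. *)
have [jN|Nj] := leqP `|(k%:Z - n%:Z)%R|%N N.
  rewrite -[theta_term _ _ _ in RHS]mul1r.
  have h := eq_mod_gauss N (n + n) k _ Q0.
  have := @eq_modM N.+1 _ _ (theta_term u v (k%:Z - n%:Z)) _ (h _ _).
  by apply; [lia | lia | |].
rewrite [RHS](fps_vanish_theta_term _ _ _ u0 v0) //.
by apply: (@fps_vanishM 0 _ _ _ _ (fps_vanish_theta_term _ _ _ u0 v0)); last exact: Nj.
Qed.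

(** * The product side: from the triple products to [phi] *)

Lemma fps_cvgM u v l m : fps_cvg u l -> fps_cvg v m ->
  fps_cvg (fun n => u n * v n) (l * m).
Proof.
move=> ul vm n.
have ev w k : fps_cvg w k -> exists N, forall i, (N <= i)%N -> eq_mod n.+1 (w i) k.
  move=> wk; elim: n.+1 => [|p [N NP]]; first by exists 0%N.
  have [M MP] := wk p; exists (maxn N M) => i; rewrite geq_max => /andP[Ni Mi] j.
  by rewrite ltnS leq_eqVlt => /orP[/eqP->|]; [exact: MP | exact: NP].
have [[N NP] [M MP]] := (ev u l ul, ev v m vm).
exists (maxn N M) => i; rewrite geq_max => /andP[Ni Mi].
by apply: (@eq_modM n.+1); [exact: NP | exact: MP |].
Qed.

Lemma fps_cvg_unique u l m : fps_cvg u l -> fps_cvg u m -> l = m.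
Proof.
move=> ul um; apply: fpsP => n.
have [[N NP] [M MP]] := (ul n, um n).
by rewrite -(NP (maxn N M)) ?leq_maxl // MP ?leq_maxr.
Qed.

Lemma fps_cvg_sub u l (g : nat -> nat) : (forall n, n <= g n)%N ->
  fps_cvg u l -> fps_cvg (u \o g) l.
Proof.
move=> gn ul n; have [N NP] := ul n; exists N => i Ni.
exact/NP/(leq_trans Ni).
Qed.

Lemma phi_partialS x n : phi_partial x n.+1 = phi_partial x n * (1 - x ^+ n.+1).
Proof. by rewrite /phi_partial big_nat_recr. Qed.

(** Both triple products have base [x ^+ 4], so a step in [n] adds six factors: exponents 4n+1 to
    4n+4 for the first partial product, 4n+2 and 4n+4 for the second. Hence the identity is exact at
    every [n]. *)
Lemma triple_products_phi_partial (x : fps) n :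
  let P u v := qfact (u * v) n *
    (\prod_(i < n) (1 + u * (u * v) ^+ i) * \prod_(i < n) (1 + v * (u * v) ^+ i)) in
  P (- x ^+ 2) (- x ^+ 2) * P (- x ^+ 3) (- x) =
  phi_partial x (4 * n) * phi_partial (x ^+ 2) (2 * n).
Proof.
have e1 : - x ^+ 2 * - x ^+ 2 = x ^+ 4 by ring.
have e2 : - x ^+ 3 * - x = x ^+ 4 by ring.
rewrite /= e1 e2; elim: n => [|n IH].
  by rewrite /qfact /phi_partial !big_ord0 !big_geq // !mulr1.
have -> : (4 * n.+1 = (4 * n).+4)%N by lia.
have -> : (2 * n.+1 = (2 * n).+2)%N by lia.
rewrite !qfactS !big_ord_recr /= !phi_partialS -!exprM.
have -> : (2 * (2 * n).+1 = (4 * n).+2)%N by lia.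
have -> : (2 * (2 * n).+2 = (4 * n).+4)%N by lia.
have -> : (4 * n.+1 = (4 * n).+4)%N by lia.
(* With y = x^(4n), the induction step becomes a polynomial identity in x and y. *)
have y4 : x ^+ (4 * n).+4 = x ^+ 4 * x ^+ (4 * n) by rewrite -exprD.
have y3 : x ^+ (4 * n).+3 = x ^+ 3 * x ^+ (4 * n) by rewrite -exprD.
have y2 : x ^+ (4 * n).+2 = x ^+ 2 * x ^+ (4 * n) by rewrite -exprD.
have y1 : x ^+ (4 * n).+1 = x * x ^+ (4 * n) by exact: exprS.
rewrite {}y4 {}y3 {}y2 {}y1; move: IH (x ^+ (4 * n)) => + y.
move: (qfact _ _) (\prod_(i < n) (1 + - x ^+ 2 * _)) (\prod_(i < n) (1 + - x ^+ 3 * _))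
  (\prod_(i < n) (1 + - x * _)) => a b c d IH.
transitivity ((a * (b * b) * (a * (c * d))) *
 ((1 - x * y) * (1 - x ^+ 2 * y) * (1 - x ^+ 3 * y) * (1 - x ^+ 4 * y) *
  (1 - x ^+ 2 * y) * (1 - x ^+ 4 * y))); first by ring.
by rewrite IH; ring.
Qed.

(** Both sides are limits of one sequence, the partial products of [phi] being taken along the
    subsequences 4n and 2n. *)
Lemma theta_f_product (x : fps) : coef x 0 = 0 ->
  theta_f (- x ^+ 2) (- x ^+ 2) * theta_f (- x ^+ 3) (- x) = phi x * phi (x ^+ 2).
Proof.
move=> x0; have xn0 k : coef (x ^+ k.+1) 0 = 0 by apply: (fps_vanishX (m := k.+1)).
have xN f : coef f 0 = 0 -> coef (- f) 0 = 0 by move=> /= ->.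
have tp1 := triple_product _ _ (xN _ (xn0 1%N)) (xN _ (xn0 1%N)).
have tp2 := triple_product _ _ (xN _ (xn0 2%N)) (xN _ x0).
have p1 := fps_cvg_sub _ _ (muln 4)
  (fun n => leq_pmull n (isT : 0 < 4)%N) (phi_cvg x0).
have p2 := fps_cvg_sub _ _ (muln 2)
  (fun n => leq_pmull n (isT : 0 < 2)%N) (phi_cvg (xn0 1%N)).
apply: (fps_cvg_unique _ _ _ _ (fps_cvgM _ _ _ _ p1 p2)).
have := fps_cvgM _ _ _ _ tp1 tp2; congr (fps_cvg _ _); apply: funext => n.
exact: triple_products_phi_partial.
Qed.

(** * The series side: splitting the double sum by parity *)

Lemma fps_summable_comp (I J : choiceType) (h : I -> J) (F : J -> fps) :
  injective h -> fps_summable F -> fps_summable (F \o h).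
Proof. by move=> ih sF n; apply: (finite_preimage (f := h)) (sF n) => ? ? _ _ /ih. Qed.

Lemma fps_sumZ (I : choiceType) (c : fps) (F : I -> fps) : fps_summable F ->
  c * fps_sum F = fps_sum (fun i => c * F i).
Proof.
move=> sF; apply: fpsP => n; have [s us sP] := fps_summable_seq _ _ n sF.
rewrite (coef_fps_sum _ _ s) //; last first.
  move=> i /fps_coefM_neq0[k kn [_ Fk]]; apply: sP Fk; exact: leq_subr.
rewrite [RHS]exchange_big /=; apply: eq_bigr => k _.
rewrite -mulr_sumr -[X in _ * X]/(coef (fps_sum F) _) (coef_fps_sum _ _ s) //.
by move=> i; apply: sP; lia.
Qed.

Lemma eq_fps_sum (I : choiceType) (F G : I -> fps) :
  F =1 G -> fps_sum F = fps_sum G.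
Proof. by move=> /funext->. Qed.

Definition even_odd_shear (p : (int * int) + (int * int)) : int * int :=
  match p with
  | inl (a, b) => (a - b, a + b)
  | inr (a, b) => (a - b, a + b + 1)
  end.

Lemma even_odd_shear_bij : bijective even_odd_shear.
Proof.
(* For a pair (d, s), the parity of d + s selects the summand; halving d + s and s - d recovers a
   and b. *)
exists (fun p => if ((p.1 + p.2) %% 2)%Z == 0
  then inl (((p.1 + p.2) %/ 2)%Z, ((p.2 - p.1) %/ 2)%Z)
  else inr (((p.1 + p.2 - 1) %/ 2)%Z, ((p.2 - p.1 - 1) %/ 2)%Z)).
- by move=> [[a b]|[a b]] /=; case: eqP => h; [congr inl|exfalso|exfalso|congr inr];
    try (congr pair); lia.
- by move=> [d s] /=; case: eqP => h /=; congr pair; lia.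
Qed.

(** Since d^2 + s^2 = 2a^2 + 2b^2, the exponent 2d^2 + 2s^2 - s has no cross term: it is (4a^2 - a)
    + (4b^2 - b). *)
Lemma theta_term_even (x : fps) a b :
  theta_term (- x ^+ 2) (- x ^+ 2) (a - b) * theta_term (- x ^+ 3) (- x) (a + b) =
  theta_term (x ^+ 5) (x ^+ 3) a * theta_term (x ^+ 5) (x ^+ 3) b.
Proof.
have := (lower_triE a, lower_triE b, lower_triE (a - b), lower_triE (a + b)).
have := (upper_triE a, upper_triE b, upper_triE (a - b), upper_triE (a + b)).
rewrite !theta_termE.
move: (lower_tri (a - b)) (lower_tri (a + b)) (upper_tri (a - b)) (upper_tri (a + b)).
move: (lower_tri a) (lower_tri b) (upper_tri a) (upper_tri b).
move=> la lb ua ub ld ls ud us [[[h1 h2] h3] h4] [[[k1 k2] k3] k4].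
have e : (x ^+ 2) ^+ ld * (x ^+ 2) ^+ ud * ((x ^+ 3) ^+ ls * x ^+ us) =
    (x ^+ 5) ^+ la * (x ^+ 3) ^+ ua * ((x ^+ 5) ^+ lb * (x ^+ 3) ^+ ub).
  by rewrite -!exprM -!exprD; congr (_ ^+ _); nia.
(* The sign exponent is d^2 + s^2 = 2(a^2 + b^2), and a^2 is [la + ua]. *)
have o : (-1) ^+ ld * (-1) ^+ ud * ((-1) ^+ ls * (-1) ^+ us) = 1 :> fps.
  rewrite -!exprD (_ : (_ + _ = 2 * (la + ua + lb + ub))%N); last by nia.
  by rewrite exprM sqrrN !expr1n.
rewrite -e -[RHS]mul1r -o !(exprNn (x ^+ 2)) (exprNn (x ^+ 3)) (exprNn x).
by ring.
Qed.

(** Here the exponent becomes 1 + (4a^2 + 3a) + (4b^2 + 3b), whence the factor [x]. *)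
Lemma theta_term_odd (x : fps) a b :
  theta_term (- x ^+ 2) (- x ^+ 2) (a - b) * theta_term (- x ^+ 3) (- x) (a + b + 1) =
  - x * (theta_term x (x ^+ 7) a * theta_term x (x ^+ 7) b).
Proof.
have := (lower_triE a, lower_triE b, lower_triE (a - b), lower_triE (a + b + 1)).
have := (upper_triE a, upper_triE b, upper_triE (a - b), upper_triE (a + b + 1)).
rewrite !theta_termE.
move: (lower_tri (a - b)) (lower_tri (a + b + 1))
  (upper_tri (a - b)) (upper_tri (a + b + 1)).
move: (lower_tri a) (lower_tri b) (upper_tri a) (upper_tri b).
move=> la lb ua ub ld ls ud us [[[h1 h2] h3] h4] [[[k1 k2] k3] k4].
have e : (x ^+ 2) ^+ ld * (x ^+ 2) ^+ ud * ((x ^+ 3) ^+ ls * x ^+ us) =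
    x * (x ^+ la * (x ^+ 7) ^+ ua * (x ^+ lb * (x ^+ 7) ^+ ub)).
  by rewrite -!exprM -!exprD -exprS; congr (_ ^+ _); nia.
(* Now d^2 + s^2 = 2(a^2 + a + b^2 + b) + 1 is odd, and a^2 + a is [2 * ua]. *)
have o : (-1) ^+ ld * (-1) ^+ ud * ((-1) ^+ ls * (-1) ^+ us) = -1 :> fps.
  rewrite -!exprD (_ : (_ + _ = (2 * (2 * (ua + ub))).+1)%N); last by nia.
  by rewrite exprS exprM sqrrN !expr1n mulr1.
rewrite mulNr -e -mulN1r -o !(exprNn (x ^+ 2)) (exprNn (x ^+ 3)) (exprNn x).
by ring.
Qed.

Theorem lemma5p2 :
  theta_f (fps_q ^+ 5) (fps_q ^+ 3) ^+ 2 - fps_q * theta_f fps_q (fps_q ^+ 7) ^+ 2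
  = phi fps_q * phi (fps_q ^+ 2).
Proof.
have q0 : coef fps_q 0 = 0 by [].
have qn0 k : coef (fps_q ^+ k.+1) 0 = 0 by apply: (fps_vanishX (m := k.+1)).
have qN f : coef f 0 = 0 -> coef (- f) 0 = 0 by move=> /= ->.
have s22 := theta_summable (qN _ (qn0 1%N)) (qN _ (qn0 1%N)).
have s31 := theta_summable (qN _ (qn0 2%N)) (qN _ q0).
have s53 := theta_summable (qn0 4%N) (qn0 2%N).
have s17 := theta_summable q0 (qn0 6%N).
rewrite -theta_f_product // /theta_f !expr2 !fps_sumM //.
(* The sum over (d, s) becomes two sums over (a, b), to be matched term by term with the two
   squares. *)
rewrite [RHS](fps_sum_bij _ _ _ _ even_odd_shear_bij) [RHS]fps_sumU; last first.
  apply: fps_summable_comp; last exact: fps_summableM.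
  exact: bij_inj even_odd_shear_bij.
rewrite -mulNr fps_sumZ; last exact: fps_summableM.
by congr (_ + _); apply: eq_fps_sum => -[a b] /=;
  rewrite ?theta_term_even ?theta_term_odd.
Qed.
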